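(* Let $\phi$ and $\Phi$ denote the standard normal density and distribution function. Let $\mathbf{x}$ be a $p$-dimensional covariate vector whose support $\mathcal{X}\subseteq\mathbb{R}^p$ contains a nonempty open set of $\mathbb{R}^p$. Let $b_0,\tilde b_0\in\mathbb{R}$, $\boldsymbol\beta,\tilde{\boldsymbol\beta}\in\mathbb{R}^p$, $\lambda,\tilde\lambda\in\mathbb{R}$, and let $Q,\tilde Q$ be probability distribution functions on $(0,\infty)$. Suppose that for all $\mathbf{x}\in\mathcal{X}$ and almost all $t>0$, $$\int_0^\infty \frac{2}{\sigma}\,\phi\!\left(\frac{\log t-b_0-\mathbf{x}^\top\boldsymbol\beta}{\sigma}\right)\Phi\!\left(\lambda\,\frac{\log t-b_0-\mathbf{x}^\top\boldsymbol\beta}{\sigma}\right)dQ(\sigma)=\int_0^\infty \frac{2}{\sigma}\,\phi\!\left(\frac{\log t-\tilde b_0-\mathbf{x}^\top\tilde{\boldsymbol\beta}}{\sigma}\right)\Phi\!\left(\tilde\lambda\,\frac{\log t-\tilde b_0-\mathbf{x}^\top\tilde{\boldsymbol\beta}}{\sigma}\right)d\tilde Q(\sigma).$$ Then $(b_0,\boldsymbol\beta^\top,\lambda,Q)=(\tilde b_0,\tilde{\boldsymbol\beta}^\top,\tilde\lambda,\tilde Q)$.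
   Context: This is the identifiability of the accelerated failure time model $\log T=b_0+\mathbf{x}^\top\boldsymbol\beta+\epsilon$ in which, given $\mathbf{x}$, $\epsilon$ has the skew-normal scale mixture density $f(\epsilon)=\int_0^\infty \frac{2}{\sigma}\phi(\epsilon/\sigma)\Phi(\lambda\epsilon/\sigma)\,dQ(\sigma)$, with slant parameter $\lambda$ and an unspecified mixing (latent) distribution $Q$ of the scale $\sigma$ on $(0,\infty)$. *)

(* Defs.v *)
From HB Require Import structures.
From mathcomp Require Import all_boot all_order all_algebra.
From mathcomp Require Import all_classical all_reals all_analysis.
From mathcomp Require Import normal_distribution.
Set Implicit Arguments. Unset Strict Implicit. Unset Printing Implicit Defensive.
Import Order.TTheory GRing.Theory Num.Theory.
Import numFieldTopology.Exports numFieldNormedType.Exports.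
Local Open Scope classical_set_scope.
Local Open Scope ring_scope.

Definition std_phi {R : realType} (x : R) : R := normal_pdf 0 1 x.
Definition std_Phi {R : realType} (x : R) : R :=
  fine (normal_prob 0 1 `]-oo, x]).

Definition dotp {R : realType} (p : nat) (x b : 'rV[R]_p) : R :=
  \sum_(i < p) x 0 i * b 0 i.

(* The density of log T at log t in the skew-normal scale mixture AFT model:
   \int_0^oo (2/s) phi(z/s) Phi(lam z/s) dQ(s), with z = log t - b0 - x^T beta. *)
Definition aft_mix_density {R : realType} (p : nat) (b0 : R) (beta : 'rV[R]_p)
  (lam : R) (Q : probability R R) (x : 'rV[R]_p) (t : R) : \bar R :=
  let z := ln t - b0 - dotp x beta in
  (\int[Q]_(s in `]0%R, +oo[) ((2 / s) * std_phi (z / s) * std_Phi (lam * (z / s)))%:E)%E.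

(* Main.v *)
Require Import Defs.
From HB Require Import structures.
From mathcomp Require Import all_boot all_order all_algebra.
From mathcomp Require Import all_classical all_reals all_analysis.
From mathcomp Require Import normal_distribution.
From mathcomp Require Import measurable_realfun ring lra.
Set Implicit Arguments.
Unset Strict Implicit.
Unset Printing Implicit Defensive.
Import Order.TTheory GRing.Theory Num.Theory.
Import numFieldTopology.Exports numFieldNormedType.Exports.
Local Open Scope classical_set_scope.
Local Open Scope ring_scope.

(* For fixed [x] put [a = b0 + x^T beta].  As [Phi u + Phi (- u) = 1], the slant
   disappears after symmetrization about [a], so testing the mixture against
   [1 + cos (t (z - a))] gives [1 + L t] with [L t = E exp (- t^2 S^2 / 2) > 0],
   where [S] has law [Q].  If the same mixture were also centered at [a' <> a],
   then for [t = pi / (a' - a)] the test functions of the two centers add up to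
   [2] whereas each of the two integrals exceeds [1].  Hence [a = a'] for all
   [x] in an open set, which gives [b0] and [beta]; then [L] is the same for both
   mixtures, and Laplace inversion for [S^2] gives [Q].  Finally the mixture
   density at any point above the center is strictly increasing in [lam]. *)

(** * The standard normal density and distribution function *)

Lemma std_phiE (R : realType) (x : R) :
  std_phi x = normal_peak 1 * expR (- x ^+ 2 / 2).
Proof.
by rewrite /std_phi normal_pdfE ?oner_neq0// /normal_fun subr0 expr1n mulr2n.
Qed.

Lemma std_phi_gt0 (R : realType) (x : R) : 0 < std_phi x.
Proof. by rewrite std_phiE mulr_gt0 ?expR_gt0// normal_peak_gt0// oner_neq0. Qed.

Lemma std_phiN (R : realType) (x : R) : std_phi (- x) = std_phi x.
Proof. by rewrite !std_phiE sqrrN. Qed.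

Lemma continuous_std_phi (R : realType) : continuous (@std_phi R).
Proof. exact/continuous_normal_pdf/oner_neq0. Qed.

Lemma integrable_std_phi (R : realType) (A : set R) : measurable A ->
  (@lebesgue_measure R).-integrable A (EFin \o @std_phi R).
Proof.
move=> mA; apply: (integrableS measurableT) => //.
exact: integrable_normal_pdf.
Qed.

Lemma is_derive_std_Phi (R : realType) (x : R) :
  is_derive x 1 (@std_Phi R) (std_phi x).
Proof.
have xx : (x < x + 1)%R by rewrite ltrDl.
(* The right endpoint [x + 1] is arbitrary: it only has to make [x] an interior point. *)
have [|||dPhi PhiE] := @continuous_FTC1 R std_phi -oo%O x (x + 1) xx.
- exact: integrable_std_phi.
- by rewrite ltNyr.
- exact: continuous_std_phi.
- by apply: DeriveDef => //; rewrite -derive1E.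
Qed.

Lemma continuous_std_Phi (R : realType) : continuous (@std_Phi R).
Proof.
move=> x; apply: differentiable_continuous; apply/derivable1_diffP.
by case: (is_derive_std_Phi x).
Qed.

Lemma std_Phi_incr (R : realType) : {homo @std_Phi R : x y / x < y}.
Proof.
move=> x y xy.
apply: (@gtr0_derive1_lt_cc R std_Phi x y) => //.
- by move=> z _; case: (is_derive_std_Phi z).
- by move=> z _; rewrite derive1E; case: (is_derive_std_Phi z) => _ ->; exact: std_phi_gt0.
- by apply: continuous_subspaceT; exact: continuous_std_Phi.
- by rewrite in_itv/= lexx ltW.
- by rewrite in_itv/= lexx ltW.
Qed.

Lemma std_Phi_ge0 (R : realType) (x : R) : 0 <= std_Phi x.
Proof. by rewrite fine_ge0. Qed.

Lemma std_Phi_le1 (R : realType) (x : R) : std_Phi x <= 1.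
Proof.
rewrite -lee_fin fineK ?fin_num_measure//; exact: probability_le1.
Qed.

(** As the density is even, [y -> - y] carries the mass of []-oo, - x]] to that of the ray from [x]
    to [+oo], whose endpoint is null. That ray is the complement of []-oo, x]]. *)
Lemma std_PhiDN (R : realType) (x : R) : std_Phi x + std_Phi (- x) = 1.
Proof.
suff -> : std_Phi (- x) = fine (normal_prob 0 1 `]x, +oo[).
  rewrite -setCitvl probability_setC//= fineB ?fin_num_measure//=.
  by rewrite -/(std_Phi x) addrC subrK.
rewrite /std_Phi; congr fine; rewrite /normal_prob.
rewrite ge0_integration_by_substitutionNy.
- rewrite integral_itv_obnd_cbnd//.
    apply: eq_integral => y _; congr EFin; exact: std_phiN.
  apply/measurable_EFinP/measurable_funTS.
  apply: (measurable_normal_pdf 0 1).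
- apply: continuous_subspaceT; exact: continuous_std_phi.
- by move=> y _; rewrite normal_pdf_ge0.
Qed.

(** * Fourier transform of the Gaussian *)

(** On growing symmetric intervals the integral is a difference of boundary values of [F], which
    tends to 0. Dominated convergence with bound [|f|] identifies the limit with the full
    integral. *)
Lemma integral_derive_eq0 (R : realType) (F f : R -> R) :
  (forall x : R, is_derive x 1 F (f x)) -> continuous f ->
  (@lebesgue_measure R).-integrable setT (EFin \o f) ->
  F n%:R @[n --> \oo] --> 0 -> F (- n%:R) @[n --> \oo] --> 0 ->
  (\int[lebesgue_measure]_x f x = 0)%R.
Proof.
move=> dF cf intf Fy FNy.
(* With [n.+1] instead of [n], the interval is never reduced to a point, as the fundamental theorem
   requires. *)
pose I n : set R := `[- n.+1%:R, n.+1%:R]%classic.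
have mI n : measurable (I n) by exact: measurable_itv.
pose f_ n x := (f \_ (I n) x)%:E.
have mf : measurable_fun setT f by exact: continuous_measurable_fun.
have [|||||_ _] := @dominated_convergence _ _ _ (@lebesgue_measure R) _
  (measurableT : measurable setT) f_ (EFin \o f) (EFin \o (fun x => `|f x|)).
- move=> n; apply/measurable_EFinP.
  apply: (iffLR (measurable_restrictT f (mI n))).
  exact: measurable_funTS.
- exact/measurable_EFinP.
- apply: aeW => x _; apply: cvg_near_cst; near=> n.
  rewrite /f_ patchE mem_set// /I/= in_itv/= -ler_norml.
  near: n; apply: filterS (nbhs_infty_ger `|x|) => n /le_trans; apply.
  by rewrite ler_nat.
- exact: (integrable_abse intf).
- apply: aeW => x n _; rewrite /f_ lee_fin patchE.
  by case: ifPn => // _; rewrite normr0.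
rewrite (_ : [sequence _]_n = fun n => (F n.+1%:R - F (- n.+1%:R))%:E); last first.
  apply/funext => n /=.
  transitivity (\int[lebesgue_measure]_(x in I n) (f x)%:E)%E.
    by rewrite [RHS]integral_mkcond restrict_EFin.
  rewrite /I (@continuous_FTC2 _ f F) //=.
  - by rewrite gtrN ?ltr0n.
  - exact: continuous_subspaceT.
  - split => [x _||].
    + by case: (dF x).
    + apply: cvg_at_right_filter; apply: differentiable_continuous.
      by apply/derivable1_diffP; case: (dF (- n.+1%:R)).
    + apply: cvg_at_left_filter; apply: differentiable_continuous.
      by apply/derivable1_diffP; case: (dF n.+1%:R).
  - by move=> x _; rewrite derive1E; case: (dF x).
move=> cvgI.
have FF : (F n.+1%:R - F (- n.+1%:R))%:E @[n --> \oo] --> (0 - 0)%:E.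
  apply: cvg_EFin; first exact: nearW.
  apply: cvgB; first by rewrite -(cvg_shiftS (fun n => F n%:R)) in Fy.
  by rewrite -(cvg_shiftS (fun n => F (- n%:R))) in FNy.
by rewrite /Rintegral (cvg_unique _ cvgI FF)//= subrr.
Unshelve. all: by end_near. Qed.

(** A linear factor is paid for by a wider Gaussian: [z^2 / 2 = z^2 / 8 + 3 z^2 / 8], where the
    first term is the exponent for standard deviation 2 and the second absorbs [|z|] through [|z| <=
    2 (1 + 3 z^2 / 8) <= 2 exp (3 z^2 / 8)]. The right-hand side is integrable without any moment
    computation. *)
Lemma std_phi_linear_le (R : realType) (z : R) :
  std_phi z * (1 + `|z|) <= std_phi z + normal_peak 1 * 2 / normal_peak 2 * normal_pdf 0 2 z.
Proof.
rewrite mulrDr mulr1 lerD2l normal_pdfE ?pnatr_eq0// mulrA divfK; last first.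
  by rewrite gt_eqF// normal_peak_gt0 ?pnatr_eq0.
rewrite std_phiE -!mulrA ler_wpM2l ?normal_peak_ge0// /normal_fun subr0.
rewrite -[leRHS]mulr1.
have -> : - z ^+ 2 / 2 = - z ^+ 2 / (2 ^+ 2 *+ 2) + - (3 / 8 * z ^+ 2).
  by rewrite -mulr_natr; field.
rewrite expRD (mulrC 2) -!mulrA ler_wpM2l ?expR_ge0// mulr1 expRN mulrC ler_pdivrMr ?expR_gt0//.
apply: (@le_trans _ _ (2 * (1 + 3 / 8 * z ^+ 2))); last first.
  by rewrite ler_wpM2l// -mulrA expR_ge1Dx.
rewrite -(real_normK (num_real z)); set y := `|z|; have := normr_ge0 z; rewrite -/y; nra.
Qed.

Lemma integrable_phiM (R : realType) (h : R -> R) (M : R) : measurable_fun setT h ->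
  (forall z, `|h z| <= M * (1 + `|z|)) ->
  (@lebesgue_measure R).-integrable setT (fun z => (std_phi z * h z)%:E).
Proof.
move=> mh hub.
have ig : (@lebesgue_measure R).-integrable setT (fun z => (M * (std_phi z +
    normal_peak 1 * 2 / normal_peak 2 * normal_pdf 0 2 z))%:E).
  under eq_fun do rewrite EFinM EFinD EFinM.
  apply: integrableZl => //; apply: integrableD => //.
    exact: integrable_std_phi.
  by apply: integrableZl => //; exact: integrable_normal_pdf.
apply: (le_integrable _ _ _ ig) => //.
  apply/measurable_EFinP/measurable_funM => //.
  exact: (measurable_normal_pdf 0 1).
have M0 : 0 <= M by rewrite (le_trans (normr_ge0 (h 0)))// (le_trans (hub 0))// normr0 addr0 mulr1.
move=> z _ /=; rewrite lee_fin normrM (gtr0_norm (std_phi_gt0 z)).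
apply: le_trans (ler_norm _).
apply: le_trans (ler_wpM2l M0 (std_phi_linear_le z)).
by rewrite mulrCA ler_wpM2l// ltW// std_phi_gt0.
Qed.

Lemma integrable_phi_cos (R : realType) (t : R) :
  (@lebesgue_measure R).-integrable setT (fun z => (std_phi z * cos (t * z))%:E).
Proof.
apply: (@integrable_phiM _ _ 1).
  apply: continuous_measurable_fun => z.
  apply: continuous_comp; last exact: continuous_cos.
  by apply: cvgM => //; exact: cvg_cst.
by move=> z; rewrite (le_trans (cos_max _))// mul1r lerDl.
Qed.

Lemma cvg_std_phi_natmul (R : realType) :
  @std_phi R n%:R @[n --> \oo] --> 0.
Proof.
apply: (@squeeze_cvgr _ _ _ _ (fun=> 0) (fun n => (normal_peak 1 * expR (1 / 2)) * expR (- n%:R))).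
- apply: nearW => n; rewrite ltW ?std_phi_gt0//= std_phiE -mulrA.
  rewrite ler_wpM2l ?normal_peak_ge0// -expRD ler_expR.
  (* Expanding the square gives [n - 1 / 2 <= n^2 / 2], whence the constant [expR (1 / 2)]. *)
  have := sqr_ge0 (n%:R - 1 : R); nra.
- exact: cvg_cst.
- rewrite -[X in _ --> X](mulr0 (normal_peak 1 * expR (1 / 2))).
  apply: cvgM; [exact: cvg_cst|exact: cvgn_expR].
Qed.

Lemma is_derive_std_phi (R : realType) (x : R) :
  is_derive x 1 (@std_phi R) (- x * std_phi x).
Proof.
have -> : @std_phi R = fun x => normal_peak 1 * expR (- x ^+ 2 / 2).
  by apply/funext => y; rewrite std_phiE.
by apply: is_derive_eq; rewrite /GRing.scale/=; field.
Qed.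

(** The integrand is the derivative of [std_phi z * sin (t * z)], which vanishes at both infinities.
    This is the integration by parts behind the differential equation of the cosine transform. *)
Lemma integral_phi_sin (R : realType) (t : R) :
  (\int[lebesgue_measure]_z (std_phi z * (t * cos (t * z) - z * sin (t * z))) = 0)%R.
Proof.
have ctz : continuous (fun z : R => t * z).
  by move=> z; apply: cvgM => //; exact: cvg_cst.
have ccos : continuous (fun z : R => cos (t * z)).
  by move=> z; apply: continuous_comp; [exact: ctz|exact: continuous_cos].
have csin : continuous (fun z : R => sin (t * z)).
  by move=> z; apply: continuous_comp; [exact: ctz|exact: continuous_sin].
have ch : continuous (fun z : R => t * cos (t * z) - z * sin (t * z)).
  move=> z; apply: cvgB; apply: cvgM => //; [exact: cvg_cst|exact: ccos|exact: csin].
apply: (@integral_derive_eq0 R (fun z => std_phi z * sin (t * z))).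
- move=> x; have dphi := is_derive_std_phi x.
  by apply: is_derive_eq; rewrite /GRing.scale/=; ring.
- by move=> z; apply: cvgM; [exact: continuous_std_phi|exact: ch].
- apply: (@integrable_phiM _ _ (`|t| + 1)); first exact: continuous_measurable_fun.
  move=> z; apply: (le_trans (ler_normB _ _)); rewrite !normrM.
  have := cos_max (t * z); have := sin_max (t * z).
  have := normr_ge0 t; have := normr_ge0 z.
  move: `|t| `|z| `|sin _| `|cos _| => a b c d a0 b0 c1 d1.
  have : b * c <= b by rewrite ler_piMr.
  have : a * d <= a by rewrite ler_piMr.
  nra.
- apply: norm_cvg0; apply: (squeeze_cvgr _ (cvg_cst 0) (@cvg_std_phi_natmul R)).
  apply: nearW => n; rewrite normr_ge0/= normrM gtr0_norm ?std_phi_gt0//.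
  by rewrite ler_piMr ?sin_max// ltW// std_phi_gt0.
- apply: norm_cvg0; apply: (squeeze_cvgr _ (cvg_cst 0) (@cvg_std_phi_natmul R)).
  apply: nearW => n; rewrite normr_ge0/= normrM gtr0_norm ?std_phi_gt0//.
  by rewrite std_phiN ler_piMr ?sin_max// ltW// std_phi_gt0.
Qed.

(** Differentiation under the integral, dominated by [std_phi z * |z|], gives minus the integral of
    [std_phi z * (z * sin (t * z))]. By [integral_phi_sin] that integral is [t] times the cosine
    transform. *)
Lemma is_derive_integral_phi_cos (R : realType) (t : R) :
  is_derive t 1 (fun t => \int[lebesgue_measure]_z (std_phi z * cos (t * z)))%R
    (- t * (\int[lebesgue_measure]_z (std_phi z * cos (t * z)))%R).
Proof.
pose f (t z : R) := std_phi z * cos (t * z).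
have df (u z : R) : is_derive u 1 (f ^~ z) (std_phi z * - (z * sin (u * z))).
  by rewrite /f; apply: is_derive_eq; rewrite /GRing.scale/=; ring.
have d1f u z : partial1of2 f u z = std_phi z * - (z * sin (u * z)).
  by rewrite partial1of2E; case: (df u z).
have intzs u : (@lebesgue_measure R).-integrable setT
    (fun z => (std_phi z * (z * sin (u * z)))%:E).
  apply: (@integrable_phiM _ _ 1).
    apply: measurable_funM => //; apply: continuous_measurable_fun => z.
    apply: continuous_comp; last exact: continuous_sin.
    by apply: cvgM => //; exact: cvg_cst.
  move=> z; rewrite normrM mul1r (@le_trans _ _ `|z|) ?lerDr//.
  by rewrite ler_piMr// sin_max.
have intG : (@lebesgue_measure R).-integrable setT (EFin \o (fun z => std_phi z * `|z|)).
  apply: (@integrable_phiM _ _ 1) => [|z].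
    by apply: continuous_measurable_fun => z; exact: norm_continuous.
  by rewrite normr_id mul1r lerDr.
have h := @cvg_differentiation_under_integral R _ _ (@lebesgue_measure R) f setT
  measurableT t (t - 1) (t + 1) _ _ _ (fun z => std_phi z * `|z|) _ intG _.
have {}h : h^-1 *: ((\int[lebesgue_measure]_z f (h + t) z)%R - (\int[lebesgue_measure]_z f t z)%R)
    @[h --> 0^'] --> (\int[lebesgue_measure]_z partial1of2 f t z)%R.
  apply: h => //=.
  - by rewrite in_itv/= ltrDl ltrBlDr ltrDl ltr01.
  - by move=> x _; exact: integrable_phi_cos.
  - by move=> y; rewrite mulr_ge0// ltW// std_phi_gt0.
  - move=> x y _ _; rewrite d1f normrM gtr0_norm ?std_phi_gt0//.
    by rewrite ler_wpM2l// ?(ltW (std_phi_gt0 _))// normrN normrM ler_piMr// sin_max.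
apply: DeriveDef.
  apply/cvg_ex; eexists; under eq_fun do rewrite scaler1; exact: h.
rewrite -derive1E; transitivity ((\int[lebesgue_measure]_z partial1of2 f t z)%R).
  exact/cvg_lim.
under eq_Rintegral do rewrite d1f.
have := integral_phi_sin t.
under eq_Rintegral do rewrite mulrBr mulrCA.
rewrite RintegralB//=; last 2 first.
  - rewrite (_ : _ \o _ = fun z => (t%:E * (std_phi z * cos (t * z))%:E)%E).
      by apply: integrableZl => //; exact: integrable_phi_cos.
    by apply/funext => z; rewrite /= EFinM.
  - exact: intzs.
rewrite RintegralZl//; last exact: integrable_phi_cos.
move=> /eqP; rewrite subr_eq0 mulNr => /eqP ->.
rewrite -mulN1r -RintegralZl//; last exact: intzs.
by apply: eq_Rintegral => z _; ring.
Qed.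

Lemma integral_phi_cos (R : realType) (t : R) :
  (\int[lebesgue_measure]_z (std_phi z * cos (t * z)))%R = expR (- t ^+ 2 / 2).
Proof.
pose C (t : R) := (\int[lebesgue_measure]_z (std_phi z * cos (t * z)))%R.
have C0 : C 0 = 1.
  rewrite /C; under eq_Rintegral do rewrite mul0r cos0 mulr1.
  by rewrite /Rintegral integral_normal_pdf.
(* The integrating factor [expR (u^2 / 2)] turns [C' = - u C] into a vanishing derivative, and the
   constant is read off at 0. *)
have dE (u : R) : is_derive u 1 (fun u => C u * expR (u ^+ 2 / 2)) 0.
  have dC := is_derive_integral_phi_cos u; rewrite -/C in dC.
  by apply: is_derive_eq; rewrite -/(C u) /GRing.scale/=; field.
have := is_derive_0_is_cst t 0 dE; rewrite C0 expr0n/= mul0r expR0 mulr1.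
move=> /= CE; rewrite -/(C t) mulNr expRN.
have e0 : expR (t ^+ 2 / 2) != 0 by rewrite gt_eqF// expR_gt0.
by apply: (mulIf e0); rewrite CE mulVf.
Qed.

(** Adding 1 to the cosine makes the test function nonnegative, so that Tonelli's theorem applies to
    the mixture with no integrability condition. *)
Lemma integral_phi_1Dcos (R : realType) (t : R) :
  (\int[lebesgue_measure]_z (std_phi z * (1 + cos (t * z)))%:E =
   (1 + expR (- t ^+ 2 / 2))%:E)%E.
Proof.
under eq_integral do rewrite mulrDr mulr1 EFinD.
rewrite integralD//; last 2 first.
  exact: integrable_std_phi.
  exact: integrable_phi_cos.
rewrite integral_normal_pdf EFinD; congr (_ + _)%E.
rewrite -integral_phi_cos /Rintegral fineK//; apply: integrable_fin_num => //.
exact: integrable_phi_cos.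
Qed.

(** * The skew-normal scale mixture *)

Lemma ge0_integral_opp (R : realType) (f : R -> \bar R) :
  measurable_fun setT f -> (forall r, (0 <= f r)%E) ->
  (\int[lebesgue_measure]_r f r = \int[lebesgue_measure]_r f (- r)%R)%E.
Proof.
move=> mf f0.
rewrite [RHS](_ : _ = \int[lebesgue_measure]_(r in
    (-%R : _ -> measurableTypeR R) @^-1` setT) (f \o -%R) r)%E; last first.
  by rewrite preimage_setT.
rewrite -ge0_integral_pushforward//=.
by apply: eq_measure_integral => //= A mA AS; exact/esym/lebesgue_measureN.
Qed.

Lemma ge0_integral_affine (R : realType) (a s : R) (G : R -> R) : 0 < s ->
  continuous G -> (forall x, 0 <= G x) ->
  (\int[lebesgue_measure]_z (G z)%:E =
   \int[lebesgue_measure]_u (s * G (s * u + a))%:E)%E.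
Proof.
move=> s0 cG G0.
have dF (x : R) : is_derive x 1 (fun u => s * u + a) s.
  by apply: is_derive_eq; rewrite /GRing.scale/=; ring.
have F' : derive1 (fun u => s * u + a) = cst s.
  by apply/funext => x; rewrite derive1E; case: (dF x).
rewrite (@increasing_ge0_integration_by_substitutionT R (fun u => s * u + a) G)//.
- by apply: eq_integral => u _; rewrite F' /= mulrC.
- by move=> x y xy; rewrite ltrD2r ltr_pM2l.
- by rewrite F'; exact: cst_continuous.
- by rewrite F'; exact: is_cvg_cst.
- by rewrite F'; exact: is_cvg_cst.
- apply: (@cvg_comp _ _ _ (fun u => s * u) (fun v => v + a) _ -oo%R) (cvg_addrr_Ny a).
  by apply: gt0_cvgMrNy => //; exact: cvg_id.
- apply: (@cvg_comp _ _ _ (fun u => s * u) (fun v => v + a) _ +oo%R) (cvg_addrr a).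
  by apply: gt0_cvgMry => //; exact: cvg_id.
Qed.

(** After the substitution [u = (z - a) / s] everything but the factor [std_Phi (lam * u)] is even.
    Averaging with the reflected integrand replaces this factor by 1/2, which cancels the 2 of the
    kernel and removes [lam]. *)
Lemma integral_kernel_1Dcos (R : realType) (a lam s t : R) : 0 < s ->
  (\int[lebesgue_measure]_z ((2 / s) * std_phi ((z - a) / s) *
     std_Phi (lam * ((z - a) / s)) * (1 + cos (t * (z - a))))%:E =
   (1 + expR (- (t * s) ^+ 2 / 2))%:E)%E.
Proof.
move=> s0.
have cos1 (x : R) : 0 <= 1 + cos x by rewrite -lerBlDl sub0r cos_geN1.
pose H (u : R) := 2 * (std_phi u * std_Phi (lam * u) * (1 + cos (t * s * u))).
have H0 u : 0 <= H u.
  by rewrite !mulr_ge0// ?std_Phi_ge0// ltW// std_phi_gt0.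
have cM (c : R) : continuous (fun u : R => c * u).
  by move=> u; apply: cvgM => //; exact: cvg_cst.
have cH : continuous H.
  move=> u; apply: cvgM; first exact: cvg_cst.
  apply: cvgM; first apply: cvgM; first exact: continuous_std_phi.
    by apply: continuous_comp; [exact: cM|exact: continuous_std_Phi].
  apply: cvgD; first exact: cvg_cst.
  by apply: continuous_comp; [exact: cM|exact: continuous_cos].
transitivity (\int[lebesgue_measure]_u (H u)%:E)%E.
  rewrite (ge0_integral_affine (- a / s) (_ : 0 < s^-1) cH H0) ?invr_gt0//.
  apply: eq_integral => z _; congr EFin; rewrite /H.
  have -> : s^-1 * z + - a / s = (z - a) / s by ring.
  have -> : t * s * ((z - a) / s) = t * (z - a) by field; rewrite gt_eqF.
  ring.
have mH : measurable_fun setT (EFin \o H).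
  by apply/measurable_EFinP; exact: continuous_measurable_fun.
have mHN : measurable_fun setT (fun u : R => (H (- u))%:E).
  by apply: (measurableT_comp mH); exact: oppr_measurable.
pose g (u : R) := std_phi u * (1 + cos (t * s * u)).
have g0 u : 0 <= g u by rewrite mulr_ge0// ltW// std_phi_gt0.
have mg : measurable_fun setT (EFin \o g).
  apply/measurable_EFinP; apply: continuous_measurable_fun => u.
  apply: cvgM; first exact: continuous_std_phi.
  apply: cvgD; first exact: cvg_cst.
  by apply: continuous_comp; [exact: cM|exact: continuous_cos].
(* The averaging is written as equality of the doubled integrals, which needs no finiteness in the
   extended reals. *)
have HE : (\int[lebesgue_measure]_u (H u)%:E + \int[lebesgue_measure]_u (H u)%:E =
    \int[lebesgue_measure]_u (g u)%:E + \int[lebesgue_measure]_u (g u)%:E)%E.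
  rewrite {1}(ge0_integral_opp mH); last by move=> u; rewrite lee_fin.
  transitivity (\int[lebesgue_measure]_u ((H (- u))%:E + (H u)%:E))%E.
    by rewrite ge0_integralD// => u _; rewrite lee_fin.
  transitivity (\int[lebesgue_measure]_u ((g u)%:E + (g u)%:E))%E; last first.
    by rewrite ge0_integralD// => u _; rewrite lee_fin.
  apply: eq_integral => u _; rewrite -!EFinD; congr EFin; rewrite /H /g /=.
  rewrite std_phiN !mulrN cosN.
  have -> : std_Phi (- (lam * u)) = 1 - std_Phi (lam * u).
    by rewrite -(std_PhiDN (lam * u)) addrC addKr.
  ring.
have gE : (\int[lebesgue_measure]_u (g u)%:E = (1 + expR (- (t * s) ^+ 2 / 2))%:E)%E.
  exact: integral_phi_1Dcos.
(* The right side is now finite, which rules out infinite values on the left and allows halving. *)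
move: HE; rewrite gE; move: (\int[_]_u _)%E => [r||]//= [rE]; congr EFin; lra.
Qed.

Definition skew_kernel (R : realType) (lam z s : R) : R :=
  (2 / s) * std_phi (z / s) * std_Phi (lam * (z / s)).

Definition skew_mix (R : realType) (lam : R) (Q : probability R R) (z : R) : \bar R :=
  (\int[Q]_(s in `]0%R, +oo[) (skew_kernel lam z s)%:E)%E.

Lemma expRNln (R : realType) (s : R) : 0 < s -> expR (- ln s) = s^-1.
Proof. by move=> s0; rewrite expRN lnK. Qed.

Lemma measurable_std_phi (R : realType) : measurable_fun setT (@std_phi R).
Proof. by apply: continuous_measurable_fun; exact: continuous_std_phi. Qed.

Lemma measurable_std_Phi (R : realType) : measurable_fun setT (@std_Phi R).
Proof. by apply: continuous_measurable_fun; exact: continuous_std_Phi. Qed.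

(* The inverse is measurable on the positive reals because there it is [expR \o -%R \o ln]. *)
Lemma measurable_skew_kernel (R : realType) (lam z : R) :
  measurable_fun (`]0%R, +oo[%classic : set R) (skew_kernel lam z).
Proof.
pose inv (s : R) := expR (- ln s).
have minv : measurable_fun setT inv.
  apply: (measurableT_comp (@measurable_expR R)).
  apply: measurable_funN.
  exact: measurable_ln.
apply: (@eq_measurable_fun _ _ _ _ _ (fun s =>
    (2 * inv s) * std_phi (z * inv s) * std_Phi (lam * (z * inv s)))).
  by move=> s; rewrite inE/= in_itv/= andbT /inv => s0; rewrite expRNln.
apply: measurable_funTS.
apply: measurable_funM; first apply: measurable_funM.
- exact: measurable_funM.
- apply: (measurableT_comp (@measurable_std_phi R)).
  exact: measurable_funM.
- apply: (measurableT_comp (@measurable_std_Phi R)).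
  by apply: measurable_funM => //; exact: measurable_funM.
Qed.

(* [skew_kernel lam (z - a) s] for [0 < s], extended by [0] into a nonnegative
   function that is jointly measurable on the whole plane. *)
Definition skew_kernel0 (R : realType) (a lam : R) (x : R * R) : R :=
  \1_(`]0%R, +oo[%classic : set R) x.2 *
  (2 * expR (- ln x.2) * std_phi ((x.1 - a) * expR (- ln x.2)) *
   std_Phi (lam * ((x.1 - a) * expR (- ln x.2)))).

Lemma skew_kernel0E (R : realType) (a lam z s : R) : 0 < s ->
  skew_kernel0 a lam (z, s) = skew_kernel lam (z - a) s.
Proof.
move=> s0; rewrite /skew_kernel0/= expRNln// indicE mem_set ?mul1r//=.
by rewrite in_itv/= s0.
Qed.

Lemma skew_kernel0_ge0 (R : realType) (a lam : R) (x : R * R) :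
  0 <= skew_kernel0 a lam x.
Proof.
apply: mulr_ge0; first by rewrite indicE ler0n.
by rewrite !mulr_ge0 ?std_Phi_ge0 ?expR_ge0// ltW// std_phi_gt0.
Qed.

Lemma measurable_skew_kernel0 (R : realType) (a lam : R) :
  measurable_fun setT (skew_kernel0 a lam).
Proof.
have minv : measurable_fun setT (fun x : R * R => expR (- ln x.2)).
  apply: (measurableT_comp (@measurable_expR R)).
  apply: measurable_funN.
  exact: (measurableT_comp (@measurable_ln R)).
have mza : measurable_fun setT (fun x : R * R => x.1 - a).
  by apply: measurable_funB.
apply: measurable_funM.
  have mD : measurable_fun setT (\1_(`]0%R, +oo[%classic : set R) : R -> R).
    exact: measurable_indic.
  exact: (measurableT_comp mD).
apply: measurable_funM; first apply: measurable_funM.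
- exact: measurable_funM.
- apply: (measurableT_comp (@measurable_std_phi R)).
  exact: measurable_funM.
- apply: (measurableT_comp (@measurable_std_Phi R)).
  by apply: measurable_funM => //; exact: measurable_funM.
Qed.

Lemma skew_mixT (R : realType) (a lam z : R) (Q : probability R R) :
  skew_mix lam Q (z - a) = (\int[Q]_s (skew_kernel0 a lam (z, s))%:E)%E.
Proof.
rewrite /skew_mix integral_mkcond; apply: eq_integral => s _.
rewrite patchE; case: ifPn => [|s0].
  by rewrite inE/= in_itv/= andbT => s0; rewrite skew_kernel0E.
by rewrite /skew_kernel0 indicE/= (negbTE s0) mul0r.
Qed.

Lemma measurable_skew_mix (R : realType) (a lam : R) (Q : probability R R) :
  measurable_fun setT (fun z : R => skew_mix lam Q (z - a)).
Proof.
under eq_fun do rewrite skew_mixT.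
have mk : measurable_fun setT (EFin \o skew_kernel0 a lam).
  by apply/measurable_EFinP; exact: measurable_skew_kernel0.
apply: (measurable_fun_fubini_tonelli_F _ mk) => x.
by rewrite lee_fin skew_kernel0_ge0.
Qed.

Lemma skew_mix_ge0 (R : realType) (lam z : R) (Q : probability R R) :
  (0 <= skew_mix lam Q z)%E.
Proof.
rewrite -(subr0 z) skew_mixT; apply: integral_ge0 => s _.
by rewrite lee_fin skew_kernel0_ge0.
Qed.

(** Tonelli exchanges the two integrals. The inner one is then [integral_kernel_1Dcos] for [0 < s],
    and it is 0 for [s <= 0], where [skew_kernel0] vanishes. *)
Lemma integral_skew_mix_1Dcos (R : realType) (a lam t : R) (Q : probability R R) :
  (\int[lebesgue_measure]_z (skew_mix lam Q (z - a) * (1 + cos (t * (z - a)))%:E) =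
   \int[Q]_(s in `]0%R, +oo[) (1 + expR (- (t * s) ^+ 2 / 2))%:E)%E.
Proof.
have cos1 (x : R) : 0 <= 1 + cos x by rewrite -lerBlDl sub0r cos_geN1.
pose F (x : R * R) : \bar R :=
  (skew_kernel0 a lam x * (1 + cos (t * (x.1 - a))))%:E.
have mF : measurable_fun setT F.
  apply/measurable_EFinP; apply: measurable_funM.
    exact: measurable_skew_kernel0.
  apply: measurable_funD => //.
  have mcos : measurable_fun setT (@cos R).
    by apply: continuous_measurable_fun; exact: continuous_cos.
  apply: (measurableT_comp mcos).
  by apply: measurable_funM => //; exact: measurable_funB.
have F_ge0 x : (0 <= F x)%E by rewrite lee_fin mulr_ge0// skew_kernel0_ge0.
transitivity (\int[lebesgue_measure]_z \int[Q]_s F (z, s))%E.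
  apply: eq_integral => z _; rewrite skew_mixT -ge0_integralZr//=.
  - apply/measurable_EFinP.
    exact: (measurableT_comp (@measurable_skew_kernel0 R a lam)).
  - by move=> s _; rewrite lee_fin skew_kernel0_ge0.
transitivity (\int[Q]_s \int[lebesgue_measure]_z F (z, s))%E.
  by have := @fubini_tonelli _ _ _ _ R (@lebesgue_measure R) Q F mF F_ge0.
rewrite [RHS]integral_mkcond; apply: eq_integral => s _.
rewrite patchE; case: ifPn => [|s0].
  rewrite inE/= in_itv/= andbT => s0.
  rewrite -(integral_kernel_1Dcos a lam t s0); apply: eq_integral => z _.
  by rewrite /F skew_kernel0E.
apply: integral0_eq => z _.
by rewrite /F /skew_kernel0 indicE/= (negbTE s0) !mul0r.
Qed.

(** * Bounds and continuity of the mixture away from its center *)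

Lemma normr_std_phi_le1 (R : realType) (x : R) : `|x| * std_phi x <= 1.
Proof.
have peak1 : normal_peak (1 : R) <= 1.
  rewrite /normal_peak invf_le1; last by rewrite sqrtr_gt0 expr1n mul1r mulrn_wgt0// pi_gt0.
  rewrite -[leLHS]sqrtr1 ler_sqrt; last by rewrite expr1n mul1r mulrn_wge0// pi_ge0.
  by rewrite expr1n mul1r -mulr_natr; have := pi_ge2 R; lra.
rewrite std_phiE mulNr expRN mulrA ler_pdivrMr ?expR_gt0// mul1r.
apply: (@le_trans _ _ `|x|); first by rewrite ler_piMr.
(* From [(|x| - 1)^2 >= 0] one gets [|x| <= 1 + x^2 / 2 <= expR (x^2 / 2)]. *)
apply: le_trans (expR_ge1Dx _); rewrite -(real_normK (num_real x)).
have := sqr_ge0 (`|x| - 1); lra.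
Qed.

Lemma skew_kernel_ge0 (R : realType) (lam z s : R) : 0 < s -> 0 <= skew_kernel lam z s.
Proof.
move=> s0; rewrite !mulr_ge0 ?std_Phi_ge0 ?invr_ge0 ?(ltW s0)//.
by rewrite ltW// std_phi_gt0.
Qed.

(** Writing [1 / s] as [|z / s| / |z|] gives a bound uniform in [s]. It degenerates only at [z = 0],
    where the mixture can be infinite when [Q] charges small scales; hence the condition [z != 0] in
    what follows. *)
Lemma skew_kernel_le (R : realType) (lam z s : R) : z != 0 -> 0 < s ->
  skew_kernel lam z s <= 2 / `|z|.
Proof.
move=> z0 s0; rewrite -normr_gt0 in z0.
apply: (@le_trans _ _ (2 / s * std_phi (z / s))).
  rewrite ler_piMr ?std_Phi_le1// !mulr_ge0 ?invr_ge0 ?(ltW s0)//.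
  by rewrite ltW// std_phi_gt0.
rewrite -mulrA ler_wpM2l// -[leRHS]mul1r ler_pdivlMr//.
have := normr_std_phi_le1 (z / s).
by rewrite normrM (gtr0_norm (_ : 0 < s^-1)) ?invr_gt0//; lra.
Qed.

Lemma integrable_skew_kernel (R : realType) (lam z : R) (Q : probability R R) : z != 0 ->
  Q.-integrable (`]0%R, +oo[%classic : set R) (EFin \o skew_kernel lam z).
Proof.
move=> z0.
have ic : Q.-integrable (`]0%R, +oo[%classic : set R) (EFin \o cst (2 / `|z|)).
  exact: finite_measure_integrable_cst.
apply: (le_integrable _ _ _ ic) => //.
  by apply/measurable_EFinP; exact: measurable_skew_kernel.
move=> s; rewrite /= in_itv/= andbT => s0; rewrite lee_fin.
rewrite ger0_norm ?skew_kernel_ge0//; apply: le_trans (ler_norm _).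
exact: skew_kernel_le.
Qed.

Lemma skew_mixE (R : realType) (lam z : R) (Q : probability R R) : z != 0 ->
  skew_mix lam Q z = (\int[Q]_(s in `]0%R, +oo[) skew_kernel lam z s)%R%:E.
Proof.
by move=> z0; rewrite /Rintegral fineK//; apply: integrable_fin_num => //;
  exact: integrable_skew_kernel.
Qed.

Lemma continuous_skew_kernel (R : realType) (lam s : R) :
  continuous (fun z => skew_kernel lam z s).
Proof.
have cM (c : R) : continuous (fun u : R => u / c).
  by move=> u; apply: cvgM => //; exact: cvg_cst.
have c1 : continuous (fun z : R => std_phi (z / s)).
  move=> z; apply: (@continuous_comp R R R (fun z : R => z / s) (@std_phi R)).
    exact: cM.
  exact: continuous_std_phi.
have c2 : continuous (fun z : R => std_Phi (lam * (z / s))).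
  move=> z; apply: (@continuous_comp R R R (fun z : R => lam * (z / s)) (@std_Phi R)).
    by apply: cvgM; [exact: cvg_cst|exact: cM].
  exact: continuous_std_Phi.
by move=> z; apply: cvgM; [apply: cvgM; [exact: cvg_cst|exact: c1]|exact: c2].
Qed.

Lemma continuous_skew_mix (R : realType) (lam : R) (Q : probability R R) (z0 : R) : z0 != 0 ->
  {for z0, continuous (fun z => \int[Q]_(s in `]0%R, +oo[) skew_kernel lam z s)%R}.
Proof.
move=> z00; have nz0 : 0 < `|z0| by rewrite normr_gt0.
(* The interval of radius [|z0| / 2] stays away from 0, so [2 / |z|] is dominated there by the
   constant [4 / |z0|]. *)
have Iz z : z \in `]z0 - `|z0| / 2, z0 + `|z0| / 2[ -> `|z0| / 2 <= `|z|.
  rewrite in_itv/= => /andP[z1 z2].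
  have : `|z0 - z| <= `|z0| / 2 by rewrite ler_norml; apply/andP; split; lra.
  by have := ler_normD (z0 - z) z; rewrite subrK; lra.
have Inz z : z \in `]z0 - `|z0| / 2, z0 + `|z0| / 2[ -> z != 0.
  by move=> /Iz h; rewrite -normr_gt0; lra.
apply: (@continuity_under_integral R _ R Q (skew_kernel lam) (`]0%R, +oo[%classic : set R) _
   (z0 - `|z0| / 2) (z0 + `|z0| / 2) _ _ (cst (4 / `|z0|))) => //.
- by move=> z Iz'; apply: integrable_skew_kernel; apply: Inz.
- by apply: aeW => s _ z _; exact: continuous_skew_kernel.
- exact: finite_measure_integrable_cst.
- move=> z Iz'; apply: aeW => s; rewrite /= in_itv/= andbT => s0.
  rewrite ger0_norm ?skew_kernel_ge0//.
  apply: (le_trans (skew_kernel_le _ (Inz _ Iz') s0)).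
  have h := Iz _ Iz'.
  rewrite ler_pdivrMr; last by lra.
  rewrite mulrAC ler_pdivlMr//; lra.
- by rewrite inE/= in_itv/=; apply/andP; split; lra.
Qed.

(** Otherwise [f - g] is nonzero on a ball of positive reals around [t0]. That ball has positive
    measure but lies in a null set. *)
Lemma ae_eq_continuous (R : realType) (f g : R -> R) (t0 : R) : 0 < t0 ->
  {for t0, continuous f} -> {for t0, continuous g} ->
  {ae (@lebesgue_measure R), forall t : R, 0 < t -> f t = g t} -> f t0 = g t0.
Proof.
move=> t00 cf cg [N [mN N0 subN]]; apply/eqP/negPn/negP => fg.
have cfg : {for t0, continuous (fun t => f t - g t)} by exact: cvgB.
have fg0 : f t0 - g t0 != 0 by rewrite subr_eq0.
have /nbhs_ballP[e /= e0 eN] : \forall t \near t0, 0 < t /\ f t - g t != 0.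
  near=> t; split.
    by near: t; apply: (cvgr_gt t0 (@cvg_id _ _)).
  by near: t; exact: (cvgr_neq0 _ cfg).
have : (lebesgue_measure (ball t0 e) <= lebesgue_measure N)%E.
  apply: le_measure; rewrite ?inE//; first exact: measurable_ball.
  move=> t /eN[t1 t2]; apply: subN => /= /(_ t1) fgt.
  by move: t2; rewrite fgt subrr eqxx.
rewrite lebesgue_measure_ball ?(ltW e0)// ; rewrite [lebesgue_measure N]N0.
by rewrite leNgt lte_fin mulrn_wgt0.
Unshelve. all: by end_near. Qed.

(** Off the two centers both sides are finite and continuous, so almost everywhere equality becomes
    equality at the point [t = expR z]. *)
Lemma skew_mix_ae_eq (R : realType) (a a' lam lam' : R) (Q Q' : probability R R) :
  {ae (@lebesgue_measure R), forall t : R, 0 < t ->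
     skew_mix lam Q (ln t - a) = skew_mix lam' Q' (ln t - a')} ->
  forall z, z != a -> z != a' -> skew_mix lam Q (z - a) = skew_mix lam' Q' (z - a').
Proof.
move=> aeQ z za za'; rewrite !skew_mixE ?subr_eq0//; congr EFin.
have ez : 0 < expR z by exact: expR_gt0.
pose m l (P : probability R R) (z : R) := (\int[P]_(s in `]0%R, +oo[) skew_kernel l z s)%R.
suff : m lam Q (ln (expR z) - a) = m lam' Q' (ln (expR z) - a') by rewrite expRK.
apply: (@ae_eq_continuous _ (fun t => m lam Q (ln t - a)) (fun t => m lam' Q' (ln t - a'))) => //.
- apply: (@continuous_comp R R R (fun t : R => ln t - a) (m lam Q)).
    by apply: cvgB; [exact: continuous_ln|exact: cvg_cst].
  by apply: continuous_skew_mix; rewrite expRK subr_eq0.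
- apply: (@continuous_comp R R R (fun t : R => ln t - a') (m lam' Q')).
    by apply: cvgB; [exact: continuous_ln|exact: cvg_cst].
  by apply: continuous_skew_mix; rewrite expRK subr_eq0.
- apply: filterS aeQ => [|t h t0]; first exact: (ae_filter_ringOfSetsType lebesgue_measure).
  by rewrite /m /Rintegral; congr fine; exact: h.
Qed.

(** * Laplace inversion *)

Lemma bernoulli_ineq (R : realDomainType) (u : R) (k : nat) : 0 <= u <= 1 ->
  1 - k%:R * u <= (1 - u) ^+ k.
Proof.
move=> /andP[u0 u1]; elim: k => [|k IHk]; first by rewrite expr0 mul0r subr0.
rewrite exprS; apply: (@le_trans _ _ ((1 - u) * (1 - k%:R * u))); last first.
  by rewrite ler_wpM2l// subr_ge0.
have : 0 <= k%:R * (u * u) by rewrite !mulr_ge0.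
by rewrite -natr1; lra.
Qed.

Lemma cvg_natM_geometric (R : realType) (y : R) : 0 <= y < 1 ->
  (n%:R * y ^+ n) @[n --> \oo] --> 0.
Proof.
move=> /andP[]; rewrite le_eqVlt => /predU1P[<- _|y0 y1].
  apply: cvg_near_cst; apply: nearW => -[|n]; first by rewrite mul0r.
  by rewrite expr0n mulr0.
pose b := - ln y.
have b0 : 0 < b by rewrite oppr_gt0 ln_lt0// y0.
have yE n : y ^+ n = expR (- (n%:R * b)).
  by rewrite /b mulrN opprK expRM_natl lnK.
rewrite -(cvg_shiftS (fun n => n%:R * y ^+ n)).
apply: (@squeeze_cvgr _ _ _ _ (fun=> 0) (fun n => 2 / b ^+ 2 * harmonic n)).
- apply: nearW => n; rewrite mulr_ge0//= ?exprn_ge0 ?(ltW y0)//.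
  rewrite yE expRN ler_pdivrMr ?expR_gt0// /harmonic.
  set x : R := n.+1%:R; have x0 : 0 < x by rewrite ltr0n.
  have xb : 0 <= x * b by rewrite ltW// mulr_gt0.
  (* The middle term equals [x]; it is bounded by means of [u^2 / 2 <= expR u] at [u = x * b]. *)
  apply: (@le_trans _ _ (2 / b ^+ 2 * x^-1 * ((x * b) ^+ 2 / 2))).
    by rewrite le_eqVlt; apply/orP; left; apply/eqP; field; rewrite !gt_eqF.
  rewrite ler_wpM2l//; first by rewrite ?mulr_ge0 ?invr_ge0 ?exprn_ge0 ?(ltW x0) ?(ltW b0).
  by have := expR_ge1Dxn 1 xb; rewrite (_ : 2`! = 2)%N//; lra.
- exact: cvg_cst.
- rewrite -[X in _ --> X](mulr0 (2 / b ^+ 2)).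
  by apply: cvgM; [exact: cvg_cst|exact: cvg_harmonic].
Qed.

(* [2 ^ n] puts the threshold at [1/2]; the factor [n] makes the limit vanish at the threshold. *)
Lemma cvg_threshold_half (R : realType) (x : R) : 0 <= x <= 1 ->
  ((1 - x ^+ n) ^+ (n * 2 ^ n)) @[n --> \oo] --> ((x < 1 / 2)%R%:R : R).
Proof.
move=> /andP[x0 x1].
have xn n : 0 <= x ^+ n <= 1 by rewrite exprn_ge0// exprn_ile1.
have eq2 n : (n * 2 ^ n)%:R * x ^+ n = n%:R * (2 * x) ^+ n.
  by rewrite natrM natrX exprMn mulrA.
have [xlt|xge] := ltP x (1 / 2).
- apply: (@squeeze_cvgr _ _ _ _ (fun n => 1 - n%:R * (2 * x) ^+ n) (fun=> 1)).
  + apply: nearW => n; rewrite -eq2 bernoulli_ineq//=.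
    have /andP[h0 h1] := xn n.
    by rewrite exprn_ile1// ?subr_ge0// gerBl.
  + rewrite -[X in _ --> X](subr0 1); apply: cvgB; first exact: cvg_cst.
    by apply: cvg_natM_geometric; apply/andP; split; lra.
  + exact: cvg_cst.
- apply: (@squeeze_cvgr _ _ _ _ (fun=> 0) (fun n => expR (- n%:R))).
  + apply: nearW => n; have /andP[h0 h1] := xn n.
    rewrite exprn_ge0 ?subr_ge0//=.
    apply: (@le_trans _ _ (expR (- x ^+ n) ^+ (n * 2 ^ n))).
      by rewrite lerXn2r// ?nnegrE ?subr_ge0// ?expR_ge0// expR_ge1Dx.
    rewrite -expRM_natl ler_expR mulrN lerN2 eq2 ler_peMr//.
    by rewrite exprn_ege1//; lra.
  + exact: cvg_cst.
  + exact: cvgn_expR.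
Qed.

Lemma bounded_integrable_probability (R : realType) (D : set R) (Q : probability R R)
    (f : R -> R) (M : R) : measurable D -> measurable_fun setT f ->
  (forall s, `|f s| <= M) -> Q.-integrable D (EFin \o f).
Proof.
move=> mD mf fM.
have ic : Q.-integrable D (EFin \o cst M) by exact: finite_measure_integrable_cst.
apply: (le_integrable _ _ _ ic) => //; first exact/measurable_EFinP/measurable_funTS.
by move=> s _; rewrite lee_fin; apply: le_trans (fM s) (ler_norm _).
Qed.

Lemma measurable_expR_Nsqr (R : realType) (c : R) :
  measurable_fun setT (fun s => expR (- (c * s) ^+ 2 / 2)).
Proof.
apply: continuous_measurable_fun => s.
apply: (@continuous_comp R R R (fun s : R => - (c * s) ^+ 2 / 2) (@expR R));
  last exact: continuous_expR.
apply: cvgM; last exact: cvg_cst.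
apply: cvgN; apply: (@continuous_comp R R R (fun s : R => c * s) (fun x => x ^+ 2)).
  by apply: cvgM; [exact: cvg_cst|exact: cvg_id].
exact: exprn_continuous.
Qed.

Section laplace_square.
Variables (R : realType) (Q Q' : probability R R).
Let D : set R := `]0%R, +oo[%classic.
Hypothesis laplace_eq : forall t : R,
  (\int[Q]_(s in D) expR (- (t * s) ^+ 2 / 2) =
   \int[Q']_(s in D) expR (- (t * s) ^+ 2 / 2))%R.

Let v (c s : R) : R := expR (- (c * s) ^+ 2 / 2).

Let v01 c s : 0 <= v c s <= 1.
Proof.
by rewrite expR_ge0 -expR0 ler_expR mulNr oppr_le0 divr_ge0// sqr_ge0.
Qed.

Let mv c : measurable_fun setT (v c).
Proof. exact: measurable_expR_Nsqr. Qed.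

Let mD : measurable D. Proof. exact: measurable_itv. Qed.

Let int_monomial (P : probability R R) a c i :
  P.-integrable D (EFin \o (fun s => a * v c s ^+ i)).
Proof.
apply: (@bounded_integrable_probability _ _ _ _ `|a|) => //.
  by apply: measurable_funM => //; exact: measurable_funX.
move=> s; have /andP[v0 v1] := v01 c s.
by rewrite normrM ler_piMr// ger0_norm ?exprn_ge0// exprn_ile1.
Qed.

(** A power of [v c] is again a Gaussian factor, with [c] rescaled by [sqrt i]. The hypothesis for
    all [t] therefore covers all monomials in [v c]. *)
Let monomial_eq a c i :
  (\int[Q]_(s in D) (a * v c s ^+ i) = \int[Q']_(s in D) (a * v c s ^+ i))%R.
Proof.
have vE s : v c s ^+ i = expR (- (Num.sqrt i%:R * c * s) ^+ 2 / 2).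
  rewrite /v -expRM_natl; congr expR.
  by rewrite -(mulrA (Num.sqrt _)) [(Num.sqrt _ * _) ^+ 2]exprMn sqr_sqrtr ?ler0n//; ring.
have h (P : probability R R) : (\int[P]_(s in D) (a * v c s ^+ i) =
    a * \int[P]_(s in D) expR (- (Num.sqrt i%:R * c * s) ^+ 2 / 2))%R.
  rewrite RintegralZl//; last first.
    have := int_monomial P 1 c i; congr (_.-integrable _ _).
    by apply/funext => s /=; rewrite mul1r.
  by congr (_ * _); apply: eq_Rintegral => s _; rewrite vE.
by rewrite !h laplace_eq.
Qed.

Let poly_eq c (p : {poly R}) :
  (\int[Q]_(s in D) p.[v c s] = \int[Q']_(s in D) p.[v c s])%R.
Proof.
(* Integrability of the partial sums is carried along the induction, since additivity of the
   real-valued integral asks for it. *)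
have h (P : probability R R) n (a : nat -> R) :
  P.-integrable D (EFin \o (fun s => \sum_(i < n) a i * v c s ^+ i)) /\
  (\int[P]_(s in D) (\sum_(i < n) a i * v c s ^+ i) =
   \sum_(i < n) \int[P]_(s in D) (a i * v c s ^+ i))%R.
  elim: n => [|n [IH1 IH2]].
    split.
      under [X in _.-integrable _ (_ \o X)]eq_fun do rewrite big_ord0.
      exact: finite_measure_integrable_cst.
    rewrite big_ord0; under eq_Rintegral do rewrite big_ord0.
    by rewrite Rintegral_cst// mul0r.
  have E : (fun s => \sum_(i < n.+1) a i * v c s ^+ i) =
     (fun s => \sum_(i < n) a i * v c s ^+ i + a n * v c s ^+ n).
    by apply/funext => s; rewrite big_ord_recr.
  rewrite E; split.
    exact: (integrableD mD IH1 (int_monomial P (a n) c n)).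
  rewrite RintegralD//; last exact: int_monomial.
  by rewrite IH2 big_ord_recr.
under eq_Rintegral do rewrite horner_coef.
rewrite (h Q _ (fun i => p`_i)).2.
under [RHS]eq_Rintegral do rewrite horner_coef.
rewrite (h Q' _ (fun i => p`_i)).2.
by apply: eq_bigr => i _; exact: monomial_eq.
Qed.

(** On [[0, 1]] these polynomials are bounded by 1 and converge pointwise to the indicator of the
    values below 1/2, so dominated convergence passes from polynomials in [v c] to an event. *)
Let cvg_indic (P : probability R R) c :
  (\int[P]_(s in D) ((1 - 'X ^+ n) ^+ (n * 2 ^ n)).[v c s])%R @[n --> \oo] -->
  (\int[P]_(s in D) (v c s < 1 / 2)%R%:R)%R.
Proof.
pose p n : {poly R} := (1 - 'X ^+ n) ^+ (n * 2 ^ n).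
have pE n s : (p n).[v c s] = (1 - v c s ^+ n) ^+ (n * 2 ^ n).
  by rewrite !hornerE.
have mp n : measurable_fun setT (fun s => (p n).[v c s]).
  rewrite [X in measurable_fun _ X](_ : _ = fun s => (1 - v c s ^+ n) ^+ (n * 2 ^ n)).
    by apply: measurable_funX; apply: measurable_funB => //; exact: measurable_funX.
  by apply/funext => s; rewrite pE.
have mi : measurable_fun setT (fun s => (v c s < 1 / 2)%R%:R : R).
  rewrite [X in measurable_fun _ X](_ : _ = \1_(v c @^-1` `]-oo, 1 / 2[%classic)).
    by apply: measurable_indic; rewrite -[X in measurable X]setTI; exact: mv.
  apply/funext => s; rewrite indicE; congr (nat_of_bool _)%:R.
  by apply/idP/idP; rewrite inE/= in_itv.
have [|||||_ _ h] := @dominated_convergence _ _ _ P D mD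
    (fun n s => (p n).[v c s]%:E) (fun s => ((v c s < 1 / 2)%R%:R)%:E) (EFin \o cst 1).
- by move=> n; apply/measurable_EFinP/measurable_funTS.
- exact/measurable_EFinP/measurable_funTS.
- apply: aeW => s _; apply: cvg_EFin; first exact: nearW.
  under eq_fun do rewrite pE.
  exact: cvg_threshold_half.
- exact: finite_measure_integrable_cst.
- apply: aeW => s n _; rewrite lee_fin pE normrX exprn_ile1//.
  have /andP[v0 v1] := v01 c s.
  by rewrite ger0_norm ?subr_ge0 ?exprn_ile1// gerBl exprn_ge0.
apply: fine_cvg; rewrite fineK; first exact: h.
apply: integrable_fin_num => //.
apply: (@bounded_integrable_probability _ _ _ _ 1) => // s.
by case: (_ < _); rewrite ?normr1 ?normr0.
Qed.

Lemma laplace_square_ray_eq (r : R) : 0 < r -> Q `]r, +oo[%classic = Q' `]r, +oo[%classic.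
Proof.
(* This [c] solves [v c r = 1 / 2]. Since [v c] decreases on the positive reals, being below 1/2
   means lying strictly beyond [r]. *)
move=> r0; pose c := Num.sqrt (2 * ln 2) / r.
have ln2 : 0 < ln 2 :> R by rewrite ln_gt0// ltr1n.
have vr s : 0 < s -> (v c s < 1 / 2) = (r < s).
  move=> s0; rewrite /v mul1r -[X in _ < X^-1]lnK ?posrE// -expRN ltr_expR mulNr ltrN2.
  rewrite /c 2!exprMn exprVn sqr_sqrtr; last by rewrite mulr_ge0// ltW.
  have -> : 2 * ln 2 / r ^+ 2 * s ^+ 2 / 2 = ln 2 * (s ^+ 2 / r ^+ 2).
    by field; rewrite gt_eqF.
  rewrite ltr_pMr// ltr_pdivlMr ?exprn_gt0// mul1r.
  by rewrite ltr_pXn2r// nnegrE ltW.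
have rD : `]r, +oo[%classic `&` D = `]r, +oo[%classic.
  by apply/setIidl => s; rewrite /D /= !in_itv/= !andbT; exact: lt_trans.
have h (P : probability R R) :
    (\int[P]_(s in D) (v c s < 1 / 2)%R%:R)%R = fine (P `]r, +oo[%classic).
  rewrite -[in RHS]rD -integral_indic//; congr fine; apply: eq_integral => s.
  rewrite inE /D /= in_itv/= andbT => s0; rewrite vr// indicE; congr (nat_of_bool _)%:R%:E.
  by apply/idP/idP; rewrite inE/= in_itv/= andbT.
rewrite -[LHS]fineK ?fin_num_measure// -[RHS]fineK ?fin_num_measure//.
congr EFin; rewrite -!h.
apply: (cvg_unique _ (cvg_indic (P := Q) (c := c))) => //.
rewrite /= (_ : (fun n => _) = (fun n =>
  \int[Q']_(s in D) ((1 - 'X ^+ n) ^+ (n * 2 ^ n)).[v c s])%R).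
  exact: cvg_indic.
by apply/funext => n; exact: poly_eq.
Qed.

End laplace_square.

(** Open right rays are stable under intersection and generate the Borel sets. Rays from a positive
    point are handled by [laplace_square_ray_eq]; the others have mass 1 under both laws. *)
Lemma laplace_square_unique (R : realType) (Q Q' : probability R R) :
  Q `]0%R, +oo[%classic = 1%E -> Q' `]0%R, +oo[%classic = 1%E ->
  (forall t : R,
    (\int[Q]_(s in `]0%R, +oo[) expR (- (t * s) ^+ 2 / 2) =
     \int[Q']_(s in `]0%R, +oo[) expR (- (t * s) ^+ 2 / 2))%R) ->
  forall A, measurable A -> Q A = Q' A.
Proof.
move=> Q1 Q1' QQ'.
have le0 (P : probability R R) (r : R) : r <= 0 ->
    P `]0%R, +oo[%classic = 1%E -> P `]r, +oo[%classic = 1%E.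
  move=> r0 P1; apply/eqP; rewrite eq_le probability_le1//= -P1.
  apply: le_measure; rewrite ?inE//.
  by move=> s /=; rewrite !in_itv/= !andbT; exact: le_lt_trans.
apply: (@measure_unique _ R R (@RGenOInfty.G R) (fun n => `]- n%:R, +oo[%classic)).
- exact: RGenOInfty.measurableE.
- move=> _ _ [x ->] [y ->]; exists (Num.max x y).
  apply/seteqP; split => s /=; rewrite !in_itv/= !andbT gt_max.
    by move=> [-> ->].
  by move=> /andP[].
- by move=> n; exists (- n%:R).
- rewrite -subTset => s _; exists (Num.truncn `|s|).+1 => //=.
  rewrite in_itv/= andbT ltrNl (le_lt_trans (ler_norm _))// normrN.
  by rewrite truncnS_gt.
- move=> _ [r ->]; have [r0|r0] := ltP 0 r; first exact: laplace_square_ray_eq.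
  by apply: (etrans (le0 Q r r0 Q1)); exact/esym/le0.
- by move=> n; rewrite -ge0_fin_numE// fin_num_measure.
Qed.

(** * Identifiability *)

(** If the integral were 0, [f] would vanish almost everywhere on the positive reals, and this set
    of mass 1 would sit in a null set. *)
Lemma Rintegral_gt0 (R : realType) (Q : probability R R) (f : R -> R) :
  Q `]0%R, +oo[%classic = 1%E ->
  Q.-integrable (`]0%R, +oo[%classic : set R) (EFin \o f) ->
  (forall s, 0 < s -> 0 < f s) -> 0 < (\int[Q]_(s in `]0%R, +oo[) f s)%R.
Proof.
move=> Q1 intf f0.
have mD : measurable (`]0%R, +oo[%classic : set R) by exact: measurable_itv.
rewrite lt_neqAle Rintegral_ge0 ?andbT; last first.
  by move=> s; rewrite /= in_itv/= andbT => /f0/ltW.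
apply/negP => /eqP f_eq0.
have mf : measurable_fun (`]0%R, +oo[%classic : set R) (EFin \o f).
  by case/integrableP : intf.
have : (\int[Q]_(s in `]0%R, +oo[) `|(EFin \o f) s| = 0)%E.
  transitivity (\int[Q]_(s in `]0%R, +oo[) (f s)%:E)%E; last first.
    rewrite -[LHS]fineK; last exact: integrable_fin_num.
    by rewrite -/(Rintegral _ _ _) -f_eq0.
  apply: eq_integral => s; rewrite inE/= in_itv/= andbT => s0.
  by rewrite ger0_norm// ltW// f0.
move=> /(ae_eq_integral_abs Q mD mf)[N [mN N0 subN]].
have : (Q `]0%R, +oo[%classic <= Q N)%E.
  apply: le_measure; rewrite ?inE// => s sD; apply: subN => /= /(_ sD)[fs0].
  by move: sD; rewrite /= in_itv/= andbT => /f0; rewrite fs0 ltxx.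
by rewrite Q1 N0 lee_fin ler10.
Qed.

Lemma integrable_expR_Nsqr (R : realType) (t : R) (Q : probability R R) :
  Q.-integrable (`]0%R, +oo[%classic : set R) (EFin \o (fun s => expR (- (t * s) ^+ 2 / 2))).
Proof.
apply: (@bounded_integrable_probability _ _ _ _ 1); first exact: measurable_itv.
  exact: measurable_expR_Nsqr.
move=> s; rewrite ger0_norm ?expR_ge0// -expR0 ler_expR mulNr oppr_le0.
by rewrite divr_ge0// sqr_ge0.
Qed.

Lemma integral_1DexpR_Nsqr (R : realType) (t : R) (Q : probability R R) :
  Q `]0%R, +oo[%classic = 1%E ->
  (\int[Q]_(s in `]0%R, +oo[) (1 + expR (- (t * s) ^+ 2 / 2))%:E =
   (1 + (\int[Q]_(s in `]0%R, +oo[) expR (- (t * s) ^+ 2 / 2))%R)%:E)%E.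
Proof.
move=> Q1; have mD : measurable (`]0%R, +oo[%classic : set R) by exact: measurable_itv.
under eq_integral do rewrite EFinD.
rewrite integralD//; last 2 first.
- exact: finite_measure_integrable_cst.
- exact: integrable_expR_Nsqr.
rewrite integral_cst// [X in (_ * X + _)%E]Q1 mule1 EFinD; congr (_ + _)%E.
by rewrite /Rintegral fineK//; apply: integrable_fin_num => //; exact: integrable_expR_Nsqr.
Qed.

Section identifiability.
Variables (R : realType) (a a' lam lam' : R) (Q Q' : probability R R).
Hypothesis Q1 : Q `]0%R, +oo[%classic = 1%E.
Hypothesis Q1' : Q' `]0%R, +oo[%classic = 1%E.
Hypothesis mixE : forall z, z != a -> z != a' ->
  skew_mix lam Q (z - a) = skew_mix lam' Q' (z - a').

Let cos1 (x : R) : 0 <= 1 + cos x. Proof. by rewrite -lerBlDl sub0r cos_geN1. Qed.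

Let mtest b t : measurable_fun setT (fun z : R => (1 + cos (t * (z - b)))%:E).
Proof.
apply/measurable_EFinP; apply: measurable_funD => //.
have mcos : measurable_fun setT (@cos R).
  by apply: continuous_measurable_fun; exact: continuous_cos.
by apply: (measurableT_comp mcos); apply: measurable_funM => //; exact: measurable_funB.
Qed.

(** The two mixtures can differ only on the null set [[set a; a']]. *)
Let test_eq (h : R -> R) : measurable_fun setT (EFin \o h) -> (forall z, 0 <= h z) ->
  (\int[lebesgue_measure]_z (skew_mix lam Q (z - a) * (h z)%:E) =
   \int[lebesgue_measure]_z (skew_mix lam' Q' (z - a') * (h z)%:E))%E.
Proof.
move=> mh h0; apply: ge0_ae_eq_integral => //.
- by apply: emeasurable_funM => //; exact: measurable_skew_mix.
- by apply: emeasurable_funM => //; exact: measurable_skew_mix.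
- by move=> z _; rewrite mule_ge0 ?lee_fin ?skew_mix_ge0.
- by move=> z _; rewrite mule_ge0 ?lee_fin ?skew_mix_ge0.
exists [set a; a']; split => //.
- by apply: measurableU.
- by rewrite null_set_setU //; exact: lebesgue_measure_set1.
- move=> z /= nz; apply: contrapT => /not_orP[za za']; apply: nz => _.
  by rewrite mixE//; apply/eqP.
Qed.

Lemma skew_mix_location : a = a'.
Proof.
apply/eqP/negPn/negP => aa'.
(* At this frequency, moving from one center to the other shifts the phase by [pi] and flips the
   sign of the cosine. *)
pose t := pi / (a' - a).
have cosE z : cos (t * (z - a)) = - cos (t * (z - a')).
  have -> : t * (z - a) = t * (z - a') + pi.
    by rewrite /t; field; rewrite subr_eq0 eq_sym.
  by rewrite cosDpi.
have L0 (P : probability R R) : P `]0%R, +oo[%classic = 1%E ->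
    0 < (\int[P]_(s in `]0%R, +oo[) expR (- (t * s) ^+ 2 / 2))%R.
  move=> P1; apply: (Rintegral_gt0 P1 (integrable_expR_Nsqr t P)) => s _.
  exact: expR_gt0.
(* The constant 2 is written as [1 + cos 0], so that the same integral formula, at frequency 0,
   evaluates the right side. *)
have : (\int[lebesgue_measure]_z (skew_mix lam Q (z - a) * (1 + cos (t * (z - a)))%:E) +
        \int[lebesgue_measure]_z (skew_mix lam Q (z - a) * (1 + cos (t * (z - a')))%:E) =
        \int[lebesgue_measure]_z (skew_mix lam Q (z - a) * (1 + cos (0 * (z - a)))%:E))%E.
  rewrite -ge0_integralD//=.
  - apply: eq_integral => z _; rewrite -ge0_muleDr ?lee_fin//.
    by rewrite -EFinD mul0r cos0 cosE; congr (_ * _%:E)%E; ring.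
  - by move=> z _; rewrite mule_ge0 ?lee_fin ?skew_mix_ge0.
  - exact: (emeasurable_funM (measurable_skew_mix a lam Q) (mtest a t)).
  - by move=> z _; rewrite mule_ge0 ?lee_fin ?skew_mix_ge0.
  - exact: (emeasurable_funM (measurable_skew_mix a lam Q) (mtest a' t)).
(* The integral tested around [a'] is transferred to the mixture centered there, where the formula
   applies. *)
have E := @test_eq (fun z => 1 + cos (t * (z - a'))) (mtest a' t) (fun z => cos1 _).
rewrite [X in (_ + X)%E = _]E !integral_skew_mix_1Dcos !integral_1DexpR_Nsqr// -EFinD => -[].
under [X in _ = 1 + X]eq_Rintegral do rewrite mul0r expr0n/= oppr0 mul0r expR0.
have mD : measurable (`]0%R, +oo[%classic : set R) by exact: measurable_itv.
rewrite (Rintegral_cst Q mD) [X in fine X]Q1 /=.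
by have := L0 Q Q1; have := L0 Q' Q1'; lra.
Qed.

Lemma skew_mix_mixing A : measurable A -> Q A = Q' A.
Proof.
move: A; apply: laplace_square_unique => // t.
have := @test_eq (fun z => 1 + cos (t * (z - a))) (mtest a t) (fun z => cos1 _).
rewrite -skew_mix_location !integral_skew_mix_1Dcos !integral_1DexpR_Nsqr//.
by move=> [tE]; apply: (addrI 1); exact: tE.
Qed.

End identifiability.

Lemma skew_mix_slant (R : realType) (z lam lam' : R) (Q Q' : probability R R) :
  Q `]0%R, +oo[%classic = 1%E ->
  (forall A, measurable A -> Q A = Q' A) ->
  0 < z -> skew_mix lam Q z = skew_mix lam' Q' z -> lam = lam'.
Proof.
move=> Q1 QQ' z0.
have -> : skew_mix lam' Q' z = skew_mix lam' Q z.
  by apply: eq_measure_integral => A mA _; exact/esym/QQ'.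
have lt_mix l l' : l < l' -> skew_mix l Q z != skew_mix l' Q z.
  move=> ll'; have z1 : z != 0 by rewrite gt_eqF.
  rewrite !skew_mixE// eqe lt_eqF//.
  have mD : measurable (`]0%R, +oo[%classic : set R) by exact: measurable_itv.
  have i1 := @integrable_skew_kernel _ l' z Q z1.
  have i2 := @integrable_skew_kernel _ l z Q z1.
  rewrite -subr_gt0 -RintegralB//.
  apply: Rintegral_gt0 => //; first exact: (integrableB mD i1 i2).
  (* For [0 < z] and every [0 < s] the argument [lam * (z / s)] strictly increases with [lam], so
     the difference of kernels is positive at each scale. *)
  move=> s s0; rewrite /skew_kernel -mulrBr mulr_gt0//.
    by rewrite mulr_gt0 ?std_phi_gt0// divr_gt0.
  by rewrite subr_gt0; apply: std_Phi_incr; rewrite ltr_pM2r// divr_gt0.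
move=> mixE; have [/lt_mix|/lt_mix|//] := ltgtP lam lam'.
- by rewrite mixE eqxx.
- by rewrite mixE eqxx.
Qed.

Lemma affine_eq_open (R : realType) (p : nat) (U : set 'rV[R]_p) (b c : R)
    (beta gamma : 'rV[R]_p) :
  open U -> U !=set0 ->
  (forall x, U x -> b + dotp x beta = c + dotp x gamma) -> b = c /\ beta = gamma.
Proof.
move=> oU [x Ux] affE.
have /nbhs_ballP[e /= e0 eU] : nbhs x U by exact: open_nbhs_nbhs.
have bg : beta = gamma.
  apply/rowP => i.
  (* Moving only coordinate [i] by [e / 2] stays in the ball, and comparing the two affine forms at
     [x] and [y] isolates the [i]-th slopes. *)
  pose y : 'rV[R]_p := \row_j (x 0 j + (if j == i then e / 2 else 0)).
  have dotpy d : dotp y d = dotp x d + e / 2 * d 0 i.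
    rewrite /dotp (bigD1 i)//= [in RHS](bigD1 i)//= mxE eqxx mulrDl -!addrA; congr (_ + _).
    rewrite addrC; congr (_ + _); apply: eq_bigr => j /negbTE ji.
    by rewrite mxE ji addr0.
  have Uy : U y.
    apply: eU; split=> // k j; rewrite (ord1 k) mxE /ball/= opprD addrA subrr sub0r normrN.
    by case: ifP => _; rewrite ?normr0// gtr0_norm ?divr_gt0//; lra.
  have := affE _ Uy; rewrite !dotpy !addrA affE// => /addrI.
  by apply: mulfI; rewrite gt_eqF// divr_gt0.
by split=> //; have := affE _ Ux; rewrite bg => /addIr.
Qed.

Lemma aft_mix_densityE (R : realType) (p : nat) (b0 lam t : R) (beta x : 'rV[R]_p)
    (Q : probability R R) :
  aft_mix_density b0 beta lam Q x t = skew_mix lam Q (ln t - (b0 + dotp x beta)).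
Proof. by rewrite /aft_mix_density /skew_mix opprD addrA. Qed.

Theorem theorem1 (R : realType) (p : nat) (X : set 'rV[R]_p)
  (b0 tb0 : R) (beta tbeta : 'rV[R]_p) (lam tlam : R)
  (Q tQ : probability R R) :
  (exists U : set 'rV[R]_p, open U /\ U !=set0 /\ U `<=` X) ->
  Q `]0%R, +oo[%classic = 1%E ->
  tQ `]0%R, +oo[%classic = 1%E ->
  (forall x, X x ->
     {ae (@lebesgue_measure R), forall t : R, 0 < t ->
        aft_mix_density b0 beta lam Q x t = aft_mix_density tb0 tbeta tlam tQ x t}) ->
  [/\ b0 = tb0, beta = tbeta, lam = tlam & (forall A, measurable A -> Q A = tQ A)].
Proof.
move=> [U [oU [[x0 Ux0] UX]]] Q1 tQ1 aeE.
have mixE x (Ux : U x) : forall z, z != b0 + dotp x beta -> z != tb0 + dotp x tbeta ->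
    skew_mix lam Q (z - (b0 + dotp x beta)) = skew_mix tlam tQ (z - (tb0 + dotp x tbeta)).
  apply: skew_mix_ae_eq; have := aeE x (UX _ Ux).
  apply: filterS => [|t tE t0]; first exact: (ae_filter_ringOfSetsType lebesgue_measure).
  by rewrite -!aft_mix_densityE tE.
have locE x (Ux : U x) : b0 + dotp x beta = tb0 + dotp x tbeta.
  exact: (skew_mix_location Q1 tQ1 (mixE x Ux)).
have [bE betaE] : b0 = tb0 /\ beta = tbeta.
  by apply: (affine_eq_open oU _ locE); exists x0.
have QE := skew_mix_mixing Q1 tQ1 (mixE x0 Ux0).
(* One unit above the common center the residual is 1, which is positive and avoids the excluded
   points. *)
split=> //; pose z := b0 + dotp x0 beta + 1.
have zn : z != b0 + dotp x0 beta by rewrite gt_eqF// ltrDl.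
have := mixE x0 Ux0 z zn; rewrite -(locE x0 Ux0) => /(_ zn).
by rewrite /z addrC addKr; apply: (skew_mix_slant Q1 QE ltr01).
Qed.
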